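(* Let $\alpha>1$ be the constant of the power function $s\mapsto s^{\alpha}$. For the non-preemptive two-processor speed-scaling scheduling problem $P2|fix_j,energy|\sum C_j$ (single-mode multiprocessor jobs on two dedicated processors, minimizing the total completion time $\sum_j C_j$ under a given energy budget $E$), a $2^{\frac{2\alpha-1}{\alpha-1}}$-approximate schedule can be found in polynomial time.
   Context: Model. A set of jobs $\mathcal{J}=\{1,\dots,n\}$ is to be scheduled non-preemptively on two speed-scalable processors, numbered $1$ and $2$, each of which processes at most one job at a time. Each job $j$ is a single-mode multiprocessor job: it is given with a prespecified nonempty subset $fix_j\subseteq\{1,2\}$ of the processors and a total processing volume (work) $V_j>0$, and it must be processed simultaneously on all processors of $fix_j$. The work is divided uniformly among these processors: each processor of $fix_j$ executes work $W_j=V_j/|fix_j|$, and all of them run at the same speed while executing job $j$. Any positive real speed is available. A processor running at speed $s$ consumes energy at rate (power) $s^{\alpha}$, where $\alpha>1$ is a constant; thus if job $j$ is run at constant speed with duration $p_j>0$, it consumes energy $|fix_j|\, W_j^{\alpha}\,p_j^{1-\alpha}$. The scheduler chooses the speeds (durations) and the start times. A schedule is feasible if the total energy consumption of all jobs is at most the given energy budget $E$. All jobs are available at time $0$; $C_j$ denotes the completion time of job $j$, and the goal is to minimize $\sum_{j\in\mathcal{J}} C_j$ over feasible schedules. A $\rho$-approximate schedule is a feasible schedule (in particular with energy consumption at most $E$) whose total completion time is at most $\rho$ times the minimum total completion time over all feasible schedules. *)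

(* Defs.v *)
From HB Require Import structures.
From mathcomp Require Import all_boot all_order all_algebra.
From mathcomp Require Import all_classical all_reals all_analysis.

Set Implicit Arguments.
Unset Strict Implicit.
Unset Printing Implicit Defensive.
Import Order.TTheory GRing.Theory Num.Theory.
Local Open Scope ring_scope.
Local Open Scope classical_set_scope.

(** * Two-processor scheduling with speed scaling *)

(* The processors 1 and 2 are the two elements of ['I_2]; the jobs are the
   elements of ['I_n]. *)
Record instance (R : realType) (n : nat) := Instance {
  fix_of : 'I_n -> {set 'I_2};
  volume : 'I_n -> R;
  budget : R
}.

Definition valid_instance (R : realType) (n : nat) (I : instance R n) : Prop :=
  [/\ forall j, fix_of I j != finset.set0,
      forall j, 0 < volume I j
    & 0 < budget I].

(* The speed of job [j] is determined by its duration: it is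
   [proc_work I j / duration S j]. *)
Record schedule (R : realType) (n : nat) := Schedule {
  start : 'I_n -> R;
  duration : 'I_n -> R
}.

Definition completion (R : realType) (n : nat) (S : schedule R n) (j : 'I_n) : R :=
  start S j + duration S j.

Definition total_completion (R : realType) (n : nat) (S : schedule R n) : R :=
  \sum_(j < n) completion S j.

Definition proc_work (R : realType) (n : nat) (I : instance R n) (j : 'I_n) : R :=
  volume I j / #|fix_of I j|%:R.

Definition energy (R : realType) (n : nat) (alpha : R) (I : instance R n)
    (S : schedule R n) : R :=
  \sum_(j < n) #|fix_of I j|%:R * proc_work I j `^ alpha
               * duration S j `^ (1 - alpha).

Definition running (R : realType) (n : nat) (S : schedule R n) (t : R)
    (j : 'I_n) : Prop :=
  start S j <= t < completion S j.

Definition feasible (R : realType) (n : nat) (alpha : R) (I : instance R n)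
    (S : schedule R n) : Prop :=
  [/\ forall j, 0 <= start S j,
      forall j, 0 < duration S j,
      forall (m : 'I_2) (t : R) (i j : 'I_n),
        m \in fix_of I i -> m \in fix_of I j ->
        running S t i -> running S t j -> i = j
    & energy alpha I S <= budget I].

Definition opt_cost (R : realType) (n : nat) (alpha : R) (I : instance R n) : R :=
  inf [set total_completion S | S in [set S | feasible alpha I S]].

Definition approx_schedule (R : realType) (n : nat) (alpha rho : R)
    (I : instance R n) (S : schedule R n) : Prop :=
  feasible alpha I S /\ total_completion S <= rho * opt_cost alpha I.

(** * Real RAM

   Inputs and outputs are real numbers, so running time is measured on a real
   RAM, written as a WHILE language over finitely many named arrays of natural
   numbers and of reals, where a scalar variable is cell 0 of an array.

   - Natural numbers (used for indices and counters) have only addition and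
     truncated subtraction, so after [t] steps they have [O(t)] bits.
   - Reals have field operations, comparison, and powers whose exponent is a
     constant of the program. There is no rounding and no conversion from reals
     to naturals.
   - The only constants are naturals and arithmetic combinations of naturals
     and [alpha]: no other real number can be stored in a program.

   Assignments and tests take one step each. Expressions occur literally in the
   program text, so the work hidden in a step is bounded by a constant depending
   on the program only. *)

Inductive cexp :=
  | CNat of nat
  | CAlpha
  | CAdd of cexp & cexp
  | CSub of cexp & cexp
  | CMul of cexp & cexp
  | CDiv of cexp & cexp.

Inductive nexp :=
  | NConst of nat
  | NGet of nat & nexp  (* array name, index *)
  | NAdd of nexp & nexp
  | NSub of nexp & nexp.

Inductive rexp :=
  | RConst of cexp
  | RGet of nat & nexp  (* array name, index *)
  | RAdd of rexp & rexp
  | RSub of rexp & rexp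
  | RMul of rexp & rexp
  | RDiv of rexp & rexp
  | RPow of rexp & cexp.

Inductive bexp :=
  | BNle of nexp & nexp
  | BRle of rexp & rexp
  | BNot of bexp
  | BAnd of bexp & bexp.

Inductive cmd :=
  | Skip
  | NSet of nat & nexp & nexp  (* array name, index, new value *)
  | RSet of nat & nexp & rexp  (* array name, index, new value *)
  | Seq of cmd & cmd
  | If of bexp & cmd & cmd
  | While of bexp & cmd.

Record state (R : realType) := State {
  nats : nat -> nat -> nat;
  reals : nat -> nat -> R
}.

Definition upd (T : Type) (m : nat -> nat -> T) (a i : nat) (v : T) : nat -> nat -> T :=
  fun b k => if (b == a) && (k == i) then v else m b k.

Fixpoint ceval (R : realType) (alpha : R) (c : cexp) : R :=
  match c with
  | CNat k => k%:R
  | CAlpha => alpha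
  | CAdd c1 c2 => ceval alpha c1 + ceval alpha c2
  | CSub c1 c2 => ceval alpha c1 - ceval alpha c2
  | CMul c1 c2 => ceval alpha c1 * ceval alpha c2
  | CDiv c1 c2 => ceval alpha c1 / ceval alpha c2
  end.

Fixpoint neval (R : realType) (s : state R) (e : nexp) : nat :=
  match e with
  | NConst k => k
  | NGet a e1 => nats s a (neval s e1)
  | NAdd e1 e2 => (neval s e1 + neval s e2)%N
  | NSub e1 e2 => (neval s e1 - neval s e2)%N
  end.

Fixpoint reval (R : realType) (alpha : R) (s : state R) (e : rexp) : R :=
  match e with
  | RConst c => ceval alpha c
  | RGet a e1 => reals s a (neval s e1)
  | RAdd e1 e2 => reval alpha s e1 + reval alpha s e2
  | RSub e1 e2 => reval alpha s e1 - reval alpha s e2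
  | RMul e1 e2 => reval alpha s e1 * reval alpha s e2
  | RDiv e1 e2 => reval alpha s e1 / reval alpha s e2
  | RPow e1 c => reval alpha s e1 `^ ceval alpha c
  end.

Fixpoint beval (R : realType) (alpha : R) (s : state R) (b : bexp) : bool :=
  match b with
  | BNle e1 e2 => (neval s e1 <= neval s e2)%N
  | BRle e1 e2 => reval alpha s e1 <= reval alpha s e2
  | BNot b1 => ~~ beval alpha s b1
  | BAnd b1 b2 => beval alpha s b1 && beval alpha s b2
  end.

(* [exec alpha s p t s']: started in [s], program [p] halts in [s'] after exactly
   [t] steps. *)
Inductive exec (R : realType) (alpha : R) (s : state R) :
    cmd -> nat -> state R -> Prop :=
  | ExecSkip : exec alpha s Skip 1 s
  | ExecNSet a i e :
      exec alpha s (NSet a i e) 1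
        (State (upd (nats s) a (neval s i) (neval s e)) (reals s))
  | ExecRSet a i e :
      exec alpha s (RSet a i e) 1
        (State (nats s) (upd (reals s) a (neval s i) (reval alpha s e)))
  | ExecSeq p1 p2 t1 t2 s1 s2 :
      exec alpha s p1 t1 s1 -> exec alpha s1 p2 t2 s2 ->
      exec alpha s (Seq p1 p2) (t1 + t2)%N s2
  | ExecIfTrue b p1 p2 t s1 :
      beval alpha s b -> exec alpha s p1 t s1 ->
      exec alpha s (If b p1 p2) t.+1 s1
  | ExecIfFalse b p1 p2 t s1 :
      ~~ beval alpha s b -> exec alpha s p2 t s1 ->
      exec alpha s (If b p1 p2) t.+1 s1
  | ExecWhileFalse b p :
      ~~ beval alpha s b -> exec alpha s (While b p) 1 s
  | ExecWhileTrue b p t1 t2 s1 s2 :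
      beval alpha s b -> exec alpha s p t1 s1 ->
      exec alpha s1 (While b p) t2 s2 ->
      exec alpha s (While b p) (t1 + t2).+1 s2.

(** * Input and output conventions *)

(* Read cell [k] of an array holding one entry per job; cells from [n] on are 0. *)
Definition job_cell (T : Type) (x0 : T) (n : nat) (f : 'I_n -> T) (k : nat) : T :=
  if insub k is Some j then f j else x0.

(* A processor set is passed as the bit mask 1, 2 or 3. *)
Definition fix_code (A : {set 'I_2}) : nat := (\sum_(m in A) 2 ^ m)%N.

(* Natural arrays: 0 holds [n], 1 the codes of the processor sets.
   Real arrays: 0 holds the energy budget, 1 the processing volumes. *)
Definition encode (R : realType) (n : nat) (I : instance R n) : state R :=
  State
    (fun a k => match a with
                | 0 => if k == 0%N then n else 0%N
                | 1 => job_cell 0%N (fun j => fix_code (fix_of I j)) k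
                | _ => 0%N
                end)
    (fun a k => match a with
                | 0 => if k == 0%N then budget I else 0
                | 1 => job_cell 0 (volume I) k
                | _ => 0
                end).

(* Start times are read off real array 2, durations off real array 3. *)
Definition decode (R : realType) (n : nat) (s : state R) : schedule R n :=
  Schedule (fun j : 'I_n => reals s 2 j) (fun j : 'I_n => reals s 3 j).

(* An instance with [n] jobs consists of [2 n + 2] numbers, so a polynomial in
   [n] is a polynomial in the size of the input. *)
Definition poly_time_approx (R : realType) (alpha rho : R) (p : cmd) : Prop :=
  exists q : {poly nat},
    forall (n : nat) (I : instance R n), valid_instance I ->
      exists (t : nat) (s : state R),
        [/\ exec alpha (encode I) p t s,
            (t <= q.[n])%N
          & approx_schedule alpha rho I (decode n s)].

(* Main.v *)
Require Import Defs.
From HB Require Import structures.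
From mathcomp Require Import all_boot all_order all_algebra.
From mathcomp Require Import all_classical all_reals all_analysis.
From mathcomp Require Import ring lra zify.

Set Implicit Arguments.
Unset Strict Implicit.
Unset Printing Implicit Defensive.
Import Order.TTheory GRing.Theory Num.Theory.
Local Open Scope ring_scope.

(* Running all jobs one after the other, as on a single machine, already gives a
   2-approximation, and [2 <= 2 `^ ((2 * alpha - 1) / (alpha - 1))].
   In a feasible schedule the jobs that complete by time [C_j] have total
   duration at most [2 C_j], since each processor runs disjoint jobs. So
   [2 * \sum_j C_j] is at least [\sum_i v_i d_i], where [v_i] counts the jobs that
   complete no earlier than [i]: the cost of running the durations [d_i] in order of
   completion on a single machine.
   The single-machine problem has a closed-form optimum. With
   [b_i = |fix_i| `^ (1 / alpha) * W_i] the energy is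
   [\sum_i b_i `^ alpha * d_i `^ (1 - alpha)]; for a fixed order, weighted AM-GM
   bounds the cost below by an increasing function of
   [\sum_i b_i * v_i `^ ((alpha - 1) / alpha)], and by rearrangement this sum is
   least when the jobs are ordered by increasing [b_i].
   The positions in this order are found by counting, without sorting. *)

(** * Rankings *)

(** Ties in [key] are broken by index, which gives a total order. It is used with [completion S] in
    the lower bound and with [scale] in the algorithm. *)
Definition before (R : realType) (n : nat) (key : 'I_n -> R) (i j : 'I_n) : bool :=
  (key i <= key j) && ((key j <= key i) ==> (i <= j)%N).

Section Before.
Variables (R : realType) (n : nat) (key : 'I_n -> R).

Lemma before_refl : reflexive (before key).
Proof. by move=> i; rewrite /before !lexx leqnn. Qed.

Lemma before_total : total (before key).
Proof.
move=> i j; rewrite /before.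
by case: (ltgtP (key i) (key j)) => //= _; case/orP: (leq_total i j) => ->; rewrite ?orbT.
Qed.

Lemma before_anti : antisymmetric (before key).
Proof.
move=> i j /andP[/andP[ij /implyP ij'] /andP[ji /implyP ji']].
by apply/val_inj/eqP; rewrite eqn_leq ij' ?ji'.
Qed.

Lemma before_trans : transitive (before key).
Proof.
move=> j i k /andP[ij /implyP ij'] /andP[jk /implyP jk'].
rewrite /before (le_trans ij jk); apply/implyP => ki.
by rewrite (leq_trans (ij' (le_trans jk ki)) (jk' (le_trans ki ij))).
Qed.

Lemma rank_subproof (i : 'I_n) : (#|[set j | (j != i) && before key i j]| < n)%N.
Proof.
rewrite -[X in (_ < X)%N]card_ord -cardsT; apply: proper_card.
apply/properP; split; first exact: finset.subsetT.
by exists i; rewrite !inE ?eqxx.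
Qed.

(** Positions are counted from the end, the last element having rank 0. *)
Definition rank (i : 'I_n) : 'I_n := Ordinal (rank_subproof i).

Lemma rankS i : (rank i).+1 = #|[set j | before key i j]|.
Proof.
rewrite (cardsD1 i) inE before_refl add1n /=; congr _.+1.
by apply: eq_card => j; rewrite !inE.
Qed.

Lemma rank_lt i j : before key i j -> i != j -> (rank j < rank i)%N.
Proof.
move=> ij nij; rewrite -ltnS !rankS; apply: proper_card.
apply/properP; split.
  by apply/fintype.subsetP => k; rewrite !inE; exact: before_trans ij.
exists i; rewrite !inE ?before_refl //.
by apply: contra nij => ji; apply/eqP/before_anti; rewrite ij.
Qed.

Lemma rank_inj : injective rank.
Proof.
move=> i j e; apply: contraTeq isT => nij.
have [ij|ji] := orP (before_total i j).
  by have := rank_lt ij nij; rewrite e ltnn.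
by rewrite eq_sym in nij; have := rank_lt ji nij; rewrite e ltnn.
Qed.

Lemma rank_antitone i j : (rank i <= rank j)%N -> key j <= key i.
Proof.
move=> rij; rewrite leNgt; apply/negP => kij.
suff : (rank j < rank i)%N by rewrite ltnNge rij.
apply: rank_lt; first by rewrite /before (ltW kij) leNgt kij.
by apply: contraTneq kij => ->; rewrite ltxx.
Qed.

(** Double counting: [d i] enters the prefix sum of [i] and that of each later element. *)
Lemma sum_before (d : 'I_n -> R) :
  \sum_(j < n) \sum_(i < n | before key i j) d i
    = \sum_(i < n) (rank i).+1%:R * d i.
Proof.
rewrite (exchange_big_dep xpredT) //=; apply: eq_bigr => i _.
rewrite rankS -sum1_card natr_sum mulr_suml.
by apply: eq_big => [j|j _]; rewrite ?inE // mul1r.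
Qed.

End Before.

(* Layer-cake: for every threshold [l] the set [l < f i] consists of the
   smallest values of [b] among all index sets of that size. *)
Lemma rearrangement (R : realType) (n : nat) (f g : 'I_n -> 'I_n)
    (b : 'I_n -> R) (phi : nat -> R) :
  injective f -> injective g ->
  (forall i j, (f i <= f j)%N -> b j <= b i) ->
  (forall l, phi l <= phi l.+1) ->
  \sum_(i < n) b i * phi (f i) <= \sum_(i < n) b i * phi (g i).
Proof.
move=> finj ginj banti phimono.
have phiE (k : 'I_n) :
    phi k = phi 0%N + \sum_(l < n) (phi l.+1 - phi l) * (l < k)%:R.
  rewrite -(big_mkord xpredT (fun l => (phi l.+1 - phi l) * (l < k)%:R)).
  rewrite (big_cat_nat (n := k)) //=; last exact: ltnW.
  rewrite [X in _ + (_ + X)]big1_seq ?addr0; last first.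
    by move=> l /andP[_]; rewrite mem_index_iota => /andP[kl _]; rewrite ltnNge kl mulr0.
  under eq_big_nat => l /andP[_ lk] do rewrite lk mulr1.
  by rewrite telescope_sumr // addrC subrK.
have card_inj (h : 'I_n -> 'I_n) (l : nat) : injective h ->
    \sum_(i < n) (l < h i)%:R = \sum_(i < n) (l < i)%:R :> R.
  by move=> hinj; rewrite [RHS](reindex_inj hinj).
have split (h : 'I_n -> 'I_n) : \sum_(i < n) b i * phi (h i) =
   \sum_(i < n) b i * phi 0%N
   + \sum_(l < n) (phi l.+1 - phi l) * \sum_(i < n) b i * (l < h i)%:R.
  transitivity (\sum_(i < n) (b i * phi 0%N +
      \sum_(l < n) (phi l.+1 - phi l) * (b i * (l < h i)%:R))).
    apply: eq_bigr => i _; rewrite phiE mulrDr mulr_sumr; congr (_ + _).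
    by apply: eq_bigr => l _; rewrite mulrCA.
  rewrite big_split /= exchange_big /=; congr (_ + _).
  by apply: eq_bigr => l _; rewrite mulr_sumr.
rewrite !split lerD2l; apply: ler_sum => l _.
apply: ler_wpM2l; first by rewrite subr_ge0.
have [f' _ ff'] := injF_bij finj.
(* Both maps exceed [l] equally often, so a constant may be subtracted from [b]. With the value of
   [b] at position [l] as that constant, every term becomes nonnegative. *)
pose th := b (f' l).
rewrite -subr_ge0 -sumrB.
have -> : \sum_(i < n) (b i * (l < g i)%:R - b i * (l < f i)%:R) =
    \sum_(i < n) (b i - th) * ((l < g i)%:R - (l < f i)%:R).
  have e0 : th * \sum_(i < n) ((l < g i)%:R - (l < f i)%:R) = 0.
    by rewrite sumrB !card_inj // subrr mulr0.
  by rewrite -[LHS]subr0 -[X in _ - X]e0 mulr_sumr -sumrB; apply: eq_bigr => i _; ring.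
apply: sumr_ge0 => i _.
have [lf|fl] := ltnP l (f i).
  have : b i <= th by apply: banti; rewrite ff' ltnW.
  by case: (l < g i)%N => /= ?; nra.
have : th <= b i by apply: banti; rewrite ff'.
by case: (l < g i)%N => /= ?; nra.
Qed.

(** * Weighted AM-GM and the bound for one job *)

(** The tangent to the exponential at [ln Z] bounds [X] and [Y] from below. The last hypothesis is
    [Z ^ alpha = X ^ (alpha - 1) * Y] in logarithms; it makes the linear terms cancel. *)
Lemma weighted_amgm (R : realType) (alpha X Y Z : R) :
  1 <= alpha -> 0 < X -> 0 < Y -> 0 < Z ->
  (alpha - 1) * ln X + ln Y = alpha * ln Z ->
  alpha * Z <= (alpha - 1) * X + Y.
Proof.
move=> a1 X0 Y0 Z0 e.
have tangent (W : R) : 0 < W -> Z * (1 + (ln W - ln Z)) <= W.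
  move=> W0; rewrite [leRHS](_ : W = Z * expR (ln W - ln Z)); last first.
    by rewrite expRD expRN !lnK ?posrE // mulrC mulfVK ?gt_eqF.
  by apply: ler_wpM2l; [exact: ltW|exact: expR_ge1Dx].
have tX := tangent _ X0; have tY := tangent _ Y0.
suff -> : alpha * Z = (alpha - 1) * (Z * (1 + (ln X - ln Z))) + Z * (1 + (ln Y - ln Z)).
  by rewrite lerD // ler_wpM2l // subr_ge0.
have -> : ln Y = alpha * ln Z - (alpha - 1) * ln X by rewrite -e addrAC subrr add0r.
by ring.
Qed.

(** In the geometric mean of the two terms on the right the duration [d] cancels. The factor
    [c ^ alpha] acts as a price per unit of energy. *)
Lemma job_lower_bound (R : realType) (alpha b c d v : R) :
  1 < alpha -> 0 < b -> 0 < c -> 0 < d -> 0 < v ->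
  alpha * (c * (b * v `^ ((alpha - 1) / alpha)))
    <= (alpha - 1) * (v * d) + c `^ alpha * (b `^ alpha * d `^ (1 - alpha)).
Proof.
move=> a1 b0 c0 d0 v0.
apply: weighted_amgm; rewrite ?ltW //; try by rewrite !mulr_gt0 ?powR_gt0.
rewrite !lnM ?posrE ?mulr_gt0 ?powR_gt0 // !ln_powR.
by field; rewrite gt_eqF // (lt_trans _ a1).
Qed.

(** * The optimal single-machine schedule *)

(** Induction on the size of [A]: once the job [l] that completes last is removed, the others end by
    [start S l], which replaces [T]. *)
Lemma sum_disjoint_durations_le (R : realType) (n : nat) (S : schedule R n)
    (A : {set 'I_n}) (T : R) :
  0 <= T ->
  (forall i, 0 <= start S i) -> (forall i, 0 < duration S i) ->
  (forall t i j, i \in A -> j \in A -> running S t i -> running S t j -> i = j) ->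
  (forall i, i \in A -> completion S i <= T) ->
  \sum_(i in A) duration S i <= T.
Proof.
move=> T0 S0 D0.
elim: {A}_.+1 {-2}A (ltnSn #|A|) T T0 => // k IH A Ak T T0 dis AT.
have [->|[i0 Ai0]] := set_0Vmem A; first by rewrite big_set0.
have [l Al lmax] := arg_maxP (completion S) Ai0.
rewrite (big_setD1 l) //= -lerBrDl.
have Dl := D0 l.
apply: le_trans (_ : start S l <= _); last by have := AT _ Al; rewrite /completion; lra.
apply: IH => //.
- by move: Ak; rewrite (cardsD1 l) [l \in A]Al.
- by move=> t i j /setD1P[_ Ai] /setD1P[_ Aj]; exact: dis.
- move=> i /setD1P[il Ai]; rewrite leNgt; apply/negP => li.
  have Cil := lmax i Ai; have Di := D0 i.
  have il' : i = l; last by rewrite il' eqxx in il.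
  (* At the later of the two start times both jobs would be running. *)
  apply: (dis (Num.max (start S i) (start S l))) => //; rewrite /running.
    rewrite le_max lexx /= gt_max li andbT.
    by rewrite /completion; lra.
  rewrite le_max lexx orbT /= gt_max (lt_le_trans _ Cil) ?/completion; lra.
Qed.

Section Schedules.
Variables (R : realType) (n : nat) (alpha : R) (I : instance R n).
Hypotheses (a1 : 1 < alpha) (Iv : valid_instance I).

Let a0 : 0 < alpha. Proof. exact: lt_trans a1. Qed.

(** For fixed [j], the jobs up to [j] in the order of completion are split by processor; those on
    one processor take at most [completion S j] in total. A job on both processors is counted twice,
    which only enlarges the sum. *)
Lemma two_processor_bound (S : schedule R n) : feasible alpha I S ->
  \sum_(i < n) (rank (completion S) i).+1%:R * duration S i
    <= 2 * total_completion S.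
Proof.
move=> [S0 D0 dis _]; rewrite -sum_before mulr_sumr; apply: ler_sum => j _.
pose A (m : 'I_2) := [set i | (m \in fix_of I i) && before (completion S) i j].
apply: le_trans (_ : \sum_(m < 2) \sum_(i in A m) duration S i <= _).
  rewrite (exchange_big_dep (before (completion S) ^~ j)) /=; last first.
    by move=> m i _; rewrite inE => /andP[].
  apply: ler_sum => i ij; have [fix0 _ _] := Iv.
  have /set0Pn[m mi] := fix0 i.
  rewrite (bigD1 m) /= ?inE ?mi ?ij // lerDl; apply: sumr_ge0 => *; exact: ltW.
rewrite mulr2n mulrDl mul1r big_ord_recl big_ord1.
have C0 : 0 <= completion S j by rewrite addr_ge0 // ltW.
apply: lerD; apply: sum_disjoint_durations_le => // [t i k|i]; rewrite !inE.
- by move=> /andP[mi _] /andP[mk _]; exact: dis mi mk.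
- by move=> /andP[_ /andP[]].
- by move=> /andP[mi _] /andP[mk _]; exact: dis mi mk.
- by move=> /andP[_ /andP[]].
Qed.

(** * The sequential schedule: cost, energy and feasibility *)

Definition scale (j : 'I_n) : R := #|fix_of I j|%:R `^ (1 / alpha) * proc_work I j.

Let fix_gt0 j : 0 < #|fix_of I j|%:R :> R.
Proof. by have [f _ _] := Iv; rewrite ltr0n card_gt0. Qed.

Let work_gt0 j : 0 < proc_work I j.
Proof. by have [_ V _] := Iv; rewrite divr_gt0. Qed.

Let scale_gt0 j : 0 < scale j.
Proof. by rewrite mulr_gt0 ?powR_gt0. Qed.

Let budget_gt0 : 0 < budget I.
Proof. by have [_ _] := Iv. Qed.

Lemma energyE (S : schedule R n) :
  energy alpha I S = \sum_(j < n) scale j `^ alpha * duration S j `^ (1 - alpha).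
Proof.
apply: eq_bigr => j _; rewrite /scale powRM ?powR_ge0 1?ltW //.
by rewrite -powRrM divrK ?unitfE ?gt_eqF // powRr1 // ltW.
Qed.

(** The [v_i] of the best order, the one by increasing [scale]. *)
Definition weight (j : 'I_n) : R := (rank scale j).+1%:R.

Let weight_gt0 j : 0 < weight j.
Proof. by rewrite ltr0n. Qed.

Definition norm_cost : R := \sum_(j < n) scale j * weight j `^ ((alpha - 1) / alpha).

(** Chosen so that, when there are jobs, the budget is used up exactly: [budget I = stretch ^ (1 -
    alpha) * norm_cost]. *)
Definition stretch : R := (norm_cost / budget I) `^ (1 / (alpha - 1)).

(* The Lagrange multiplier conditions for minimising [\sum_j weight j * p j]
   within the energy budget give [p j = stretch * scale j * weight j ^ (-1/alpha)]. *)
Definition opt_duration (j : 'I_n) : R :=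
  stretch * (scale j * weight j `^ ((0 - 1) / alpha)).

Definition opt_start (j : 'I_n) : R :=
  \sum_(i < n | before scale i j && ~~ before scale j i) opt_duration i.

Definition sequential : schedule R n := Schedule opt_start opt_duration.

Lemma sequential_completion j :
  completion sequential j = \sum_(i < n | before scale i j) opt_duration i.
Proof.
rewrite (bigD1 j) ?before_refl //= addrC; congr (_ + _); apply: eq_bigl => i.
case ij: (before scale i j) => //=.
have [->|nij] := eqVneq i j; first by rewrite before_refl.
by apply: contra_neqN nij => ji; apply: (@before_anti _ _ scale); rewrite ij.
Qed.

Lemma norm_cost_ge0 : 0 <= norm_cost.
Proof. by apply: sumr_ge0 => j _; rewrite mulr_ge0 ?powR_ge0 // ltW. Qed.

Lemma norm_cost_gt0 (j : 'I_n) : 0 < norm_cost.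
Proof.
rewrite /norm_cost (bigD1 j) //=; apply: ltr_wpDr.
  by apply: sumr_ge0 => i _; rewrite mulr_ge0 ?powR_ge0 // ltW.
by apply: mulr_gt0 => //; apply: powR_gt0.
Qed.

Lemma stretch_gt0 (j : 'I_n) : 0 < stretch.
Proof. by rewrite powR_gt0 // divr_gt0 // (norm_cost_gt0 j). Qed.

Lemma opt_duration_gt0 j : 0 < opt_duration j.
Proof. by rewrite mulr_gt0 ?(stretch_gt0 j) // mulr_gt0 // powR_gt0. Qed.

(** At the price [stretch ^ alpha] the whole budget is worth exactly the cost of the sequential
    schedule. *)
Lemma stretch_pow : stretch `^ alpha * budget I = stretch * norm_cost.
Proof.
have a10 : alpha - 1 != 0 by rewrite subr_eq0 gt_eqF.
have -> : stretch `^ alpha = stretch * (norm_cost / budget I).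
  have q0 : 0 <= norm_cost / budget I by rewrite divr_ge0 ?norm_cost_ge0 // ltW.
  (* The quotient vanishes when there are no jobs; [stretch] is then 0 as well. *)
  have [q|q] := eqVneq (norm_cost / budget I) 0.
    have s0 : stretch = 0 by rewrite /stretch q powR0 // mul1r invr_eq0.
    by rewrite q mulr0 s0 powR0 // gt_eqF.
  rewrite /stretch -[X in _ = _ * X]powRr1 // -powRrM -powRD; last first.
    by rewrite (negbTE q) implybT.
  by congr (_ `^ _); field.
by rewrite -mulrA divfK // gt_eqF.
Qed.

Lemma sequential_cost : total_completion sequential = stretch * norm_cost.
Proof.
under [LHS]eq_bigr do rewrite sequential_completion.
rewrite sum_before mulr_sumr; apply: eq_bigr => j _.
rewrite /opt_duration -/(weight j) mulrCA; congr (_ * _); rewrite mulrCA; congr (_ * _).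
rewrite -{1}[weight j]powRr1 ?ltW // -powRD; last by rewrite (gt_eqF (weight_gt0 j)) implybT.
by congr (_ `^ _); field; rewrite gt_eqF.
Qed.

Lemma sequential_energy : energy alpha I sequential <= budget I.
Proof.
have [n0|n0] := posnP n.
  rewrite energyE big1 ?ltW // => -[k kn]; exfalso; by rewrite n0 in kn.
have c0 := stretch_gt0 (Ordinal n0); have K0 := norm_cost_gt0 (Ordinal n0).
have a10 : alpha - 1 != 0 by rewrite subr_eq0 gt_eqF.
rewrite energyE /=.
have -> : budget I = stretch `^ (1 - alpha) * norm_cost.
  apply: (mulfI (lt0r_neq0 (powR_gt0 alpha c0))).
  rewrite stretch_pow mulrA -powRD ?(gt_eqF c0) ?implybT //.
  by rewrite addrCA subrr addr0 powRr1 // ltW.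
(* The budget is met with equality, job by job. *)
rewrite mulr_sumr le_eqVlt; apply/orP; left; apply/eqP/eq_bigr => j _.
rewrite /opt_duration; move: (scale j) (weight j) (scale_gt0 j) (weight_gt0 j) => b w b0 w0.
rewrite !powRM ?mulr_ge0 ?powR_ge0 ?(ltW c0) ?(ltW b0) //.
rewrite mulrCA; congr (_ * _); rewrite mulrA -powRD ?(gt_eqF b0) ?implybT //.
rewrite addrCA subrr addr0 powRr1 ?ltW // -powRrM; congr (_ * _ `^ _).
by field; rewrite gt_eqF.
Qed.

Lemma sequential_feasible : feasible alpha I sequential.
Proof.
split=> [j|j|m t i j _ _|]; [|exact: opt_duration_gt0| |exact: sequential_energy].
  by apply: sumr_ge0 => i _; apply: ltW; exact: opt_duration_gt0.
wlog ij : i j / before scale i j.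
  move=> H ri rj; have [ij|ji] := orP (before_total scale i j); first exact: H.
  by apply/esym; exact: H.
move=> /andP[_ ti] /andP[tj _]; apply: contraTeq ti => nij.
(* Every job up to [i] strictly precedes [j], so the sum giving the completion of [i] is part of the
   sum giving the start of [j]. *)
rewrite -leNgt sequential_completion; apply: le_trans tj.
rewrite /= /opt_start big_mkcond [leRHS]big_mkcond /=; apply: ler_sum => k _.
case: ifP => [ki|_]; last by case: ifP => // _; exact/ltW/opt_duration_gt0.
rewrite (before_trans ki ij) /=; case: ifP => // /negbFE jk.
by case/eqP: nij; apply: (@before_anti _ _ scale); rewrite ij (before_trans jk ki).
Qed.

(** Lagrangian duality: [job_lower_bound] is summed over the jobs with [c := stretch], where [v]
    comes from the order of completion in [S]. *)
Lemma feasible_lower_bound (S : schedule R n) : feasible alpha I S ->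
  stretch * norm_cost <= 2 * total_completion S.
Proof.
move=> FS; apply: le_trans (two_processor_bound FS).
have [n0|n0] := posnP n.
  by rewrite /norm_cost !big1 ?mulr0 // => -[k kn]; exfalso; rewrite n0 in kn.
have c0 := stretch_gt0 (Ordinal n0).
have [_ D0 _ Eb] := FS.
pose v i : R := (rank (completion S) i).+1%:R.
have key : alpha * (stretch * norm_cost) <=
    (alpha - 1) * \sum_(i < n) v i * duration S i + stretch `^ alpha * energy alpha I S.
  apply: le_trans (_ : alpha * (stretch *
      \sum_(i < n) scale i * v i `^ ((alpha - 1) / alpha)) <= _).
    (* Rearrangement exchanges the order of completion in [S] for the order by [scale]. *)
    rewrite ler_pM2l // ler_pM2l //.
    apply: (rearrangement (phi := fun k => k.+1%:R `^ ((alpha - 1) / alpha))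
             (@rank_inj _ _ scale) (@rank_inj _ _ (completion S))).
      by move=> i j; exact: rank_antitone.
    move=> l; apply: ge0_ler_powR; rewrite ?nnegrE ?ler_nat //.
    by rewrite divr_ge0 ?subr_ge0 // ltW.
  rewrite energyE !mulr_sumr -big_split /=; apply: ler_sum => i _.
  by apply: job_lower_bound => //; rewrite ltr0n.
(* The energy term is at most [stretch * norm_cost]; subtracting it leaves the factor [alpha - 1] on
   both sides. *)
have := ler_wpM2l (ltW (powR_gt0 alpha c0)) Eb.
rewrite stretch_pow -/v => h.
have a10 : 0 < alpha - 1 by rewrite subr_gt0.
rewrite -(ler_pM2l a10).
move: key h; rewrite /v; lra.
Qed.

End Schedules.

(** * The real-RAM program *)

(** A Hoare triple for total correctness, with a time bound. *)
Definition terminates (R : realType) (alpha : R) (s : state R) (p : cmd)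
    (T : nat) (Q : state R -> Prop) : Prop :=
  exists t s', [/\ exec alpha s p t s', (t <= T)%N & Q s'].

Definition for_loop (x : nat) (body : cmd) : cmd :=
  Seq (NSet x (NConst 0) (NConst 0))
    (While (BNot (BNle (NGet 0 (NConst 0)) (NGet x (NConst 0))))
      (Seq body (NSet x (NConst 0) (NAdd (NGet x (NConst 0)) (NConst 1))))).

Definition set_counter (R : realType) (s : state R) (x k : nat) : state R :=
  State (upd (nats s) x 0 k) (reals s).

Lemma terminates_seq (R : realType) (alpha : R) (s : state R) p q T U Q Q' :
  terminates alpha s p T Q -> (forall s', Q s' -> terminates alpha s' q U Q') ->
  terminates alpha s (Seq p q) (T + U) Q'.
Proof.
move=> [t [s1 [e1 le1 q1]]] /(_ _ q1) [u [s2 [e2 le2 q2]]].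
by exists (t + u)%N, s2; split; [exact: ExecSeq e1 e2|exact: leq_add|].
Qed.

(** Each round costs the body, the test and the increment, hence [T.+2]; the final 2 pays for the
    initialisation and the failing test. *)
Lemma for_loop_terminates (R : realType) (alpha : R) (s : state R) (x : nat)
    (body : cmd) (n T : nat) (P : nat -> state R -> Prop) :
  (forall k s', P k s' -> nats s' 0 0 = n /\ nats s' x 0 = k) ->
  P 0%N (set_counter s x 0) ->
  (forall k s', (k < n)%N -> P k s' ->
     terminates alpha s' body T
       (fun s'' => nats s'' x 0 = k /\ P k.+1 (set_counter s'' x k.+1))) ->
  terminates alpha s (for_loop x body) (n * T.+2 + 2) (P n).
Proof.
move=> Pn P0 Pstep.
suff loop m k s' : (k + m)%N = n -> P k s' ->
    terminates alpha s' (While (BNot (BNle (NGet 0 (NConst 0)) (NGet x (NConst 0))))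
      (Seq body (NSet x (NConst 0) (NAdd (NGet x (NConst 0)) (NConst 1)))))
      (m * T.+2 + 1) (P n).
  have [t [s' [e le q]]] := loop n 0%N _ erefl P0.
  exists (1 + t)%N, s'; split=> //; last by lia.
  by apply: ExecSeq e; exact: ExecNSet.
elim: m k s' => [|m IH] k s' kmn Pk; have [n0 xk] := Pn _ _ Pk.
  exists 1%N, s'; split=> //; last by rewrite -kmn addn0.
  by apply: ExecWhileFalse; rewrite /= n0 xk -kmn addn0 leqnn.
have kn : (k < n)%N by rewrite -kmn addnS ltnS leq_addr.
have [t1 [s1 [e1 le1 [xk1 P1]]]] := Pstep k s' kn Pk.
have [|t2 [s2 [e2 le2 P2]]] := IH k.+1 _ _ P1; first by rewrite addSnnS.
exists (t1 + 1 + t2).+1, s2; split=> //; last by rewrite mulSn; lia.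
apply: ExecWhileTrue e2; first by rewrite /= n0 xk -ltnNge.
apply: ExecSeq e1 _; have -> : k.+1 = (k + 1)%N by rewrite addn1.
by rewrite -xk1; exact: ExecNSet.
Qed.

(* The natural arrays 0 and 1 hold the input and are never modified; the arrays
   from 2 on are not constrained, since they hold the loop counters. *)
Definition memory (R : realType) (N : nat -> nat -> nat) (v : nat -> nat -> R)
    (s : state R) : Prop :=
  (forall a k, (a < 2)%N -> nats s a k = N a k) /\
  (forall a k, reals s a k = v a k).

Definition loop_i := NGet 2 (NConst 0).
Definition loop_j := NGet 3 (NConst 0).

(** Every phase of the program has this form; a plain assignment is a sum over one index,
    accumulated into a zero cell. *)
Definition sum_loop (a : nat) (b : bexp) (e : rexp) : cmd :=
  for_loop 2 (for_loop 3
    (If b (RSet a loop_i (RAdd (RGet a loop_i) e)) Skip)).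

(** In the second hypothesis [v'] is arbitrary on array [a]: the values of [b] and [e] must not
    depend on the array being written. *)
Lemma sum_loop_terminates (R : realType) (alpha : R) (N : nat -> nat -> nat)
    (v : nat -> nat -> R) (s : state R) (a : nat) (b : bexp) (e : rexp)
    (B : nat -> nat -> bool) (F : nat -> nat -> R) (n := N 0%N 0%N) :
  memory N v s ->
  (forall i j v' s', (i < n)%N -> (j < n)%N ->
     (forall c k, c != a -> v' c k = v c k) -> memory N v' s' ->
     nats s' 2 0 = i -> nats s' 3 0 = j ->
     beval alpha s' b = B i j /\ reval alpha s' e = F i j) ->
  terminates alpha s (sum_loop a b e) (n * (n * 4 + 4) + 2)
    (memory N (fun c k => if (c == a) && (k < n)%N
                          then v a k + \sum_(j < n | B k j) F k j else v c k)).
Proof.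
move=> [Ns vs] be.
(* [row i j] is the content of cell [i] after [j] inner rounds, [vi i] the real memory after [i]
   full rows, and [vij i j] the memory [j] rounds into row [i]. *)
pose row i j := v a i + \sum_(0 <= l < j | B i l) F i l.
pose vi i := fun c k => if (c == a) && (k < i)%N then row k n else v c k.
pose vij i j := fun c k => if (c == a) && (k == i) then row i j else vi i c k.
have [t [s' [ex le [[N' v'] _]]]] : terminates alpha s (sum_loop a b e)
    (n * (n * 4 + 2).+2 + 2) (fun s' => memory N (vi n) s' /\ nats s' 2 0 = n).
  apply: (for_loop_terminates (n := n)
    (P := fun i s' => memory N (vi i) s' /\ nats s' 2 0 = i)).
  - by move=> k s' [[N' _] ->]; rewrite N'.
  - split=> //; split=> [c k c2|c k] /=; last by rewrite vs /vi ltn0 andbF.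
    by rewrite /upd; case: eqP c2 => [->|_] //= c2; exact: Ns.
  - move=> i s1 lin [[N1 v1] i1].
    have [t [s' [ex le [[N' v'] [i' j']]]]] : terminates alpha s1 (for_loop 3
        (If b (RSet a loop_i (RAdd (RGet a loop_i) e)) Skip)) (n * 4 + 2)
        (fun s' => memory N (vij i n) s' /\ nats s' 2 0 = i /\ nats s' 3 0 = n).
      apply: (for_loop_terminates (n := n) (T := 2)
        (P := fun j s' => memory N (vij i j) s' /\ nats s' 2 0 = i /\ nats s' 3 0 = j)).
      + by move=> k s' [[N' _] [_ ->]]; rewrite N'.
      + split=> //; split=> [c k c2|c k] /=.
          by rewrite /upd; case: eqP c2 => [->|_] //= c2; exact: N1.
        rewrite v1 /vij; case: ifP => // /andP[/eqP -> /eqP ->].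
        by rewrite /vi ltnn andbF /row big_geq // addr0.
      + move=> j s2 ljn [[N2 v2] [i2 j2]].
        have [c k ca||||eb ee] := be i j (vij i j) s2 lin ljn => //.
          by rewrite /vij /vi (negbTE ca).
        have rowS : row i j.+1 = if B i j then row i j + F i j else row i j.
          rewrite /row big_mkcond big_nat_recr //= -big_mkcond /=.
          by case: ifP => _; rewrite ?addrA ?addr0.
        case Bij: (B i j).
        * exists 2%N; eexists; split=> //.
            by apply: ExecIfTrue; [rewrite eb|exact: ExecRSet].
          split=> //; split=> //; split=> [c k c2|c k] /=.
            by rewrite /upd; case: eqP c2 => [->|_] //= c2; exact: N2.
          rewrite /upd i2 ee !v2 /vij rowS Bij !eqxx /=.
          by case: (_ && _).
        * exists 2%N; eexists; split=> //.
            by apply: ExecIfFalse; [rewrite eb Bij|exact: ExecSkip].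
          split=> //; split=> //; split=> [c k c2|c k] /=.
            by rewrite /upd; case: eqP c2 => [->|_] //= c2; exact: N2.
          by rewrite v2 /vij rowS Bij.
    exists t, s'; split=> //; split=> //; split=> //; split=> [c k c2|c k] /=.
      by rewrite /upd; case: eqP c2 => [->|_] //= c2; exact: N'.
    rewrite v' /vij /vi ltnS (leq_eqVlt k).
    case: eqP => //= _; case: eqP => [->|] //=.
exists t, s'; split=> //; first by move: le; rewrite -[_.+2 in X in (_ <= X)%N -> _]addn2 -addnA.
by split=> // c k; rewrite v' /vi /row big_mkord.
Qed.

Lemma job_cell_ord (T : Type) (x0 : T) (n : nat) (f : 'I_n -> T) (j : 'I_n) :
  job_cell x0 f j = f j.
Proof. by rewrite /job_cell valK. Qed.

Definition frame (R : realType) (a : nat) (s s' : state R) : Prop :=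
  (forall b k, (b < 2)%N -> nats s' b k = nats s b k) /\
  (forall c k, c != a -> reals s' c k = reals s c k).

(** Loop counters are plain naturals, so [B] and [F] are extended by default values beyond the
    jobs. *)
Lemma sum_loop_array (R : realType) (alpha : R) (n : nat) (s : state R)
    (a : nat) (b : bexp) (e : rexp) (B : rel 'I_n) (F : 'I_n -> 'I_n -> R)
    (f : 'I_n -> R) :
  nats s 0 0 = n ->
  (forall (i j : 'I_n) s', frame a s s' ->
     nats s' 2 0 = i -> nats s' 3 0 = j ->
     beval alpha s' b = B i j /\ reval alpha s' e = F i j) ->
  (forall i : 'I_n, reals s a i + \sum_(j < n | B i j) F i j = f i) ->
  terminates alpha s (sum_loop a b e) (n * (n * 4 + 4) + 2)
    (fun s' => frame a s s' /\ forall i : 'I_n, reals s' a i = f i).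
Proof.
move=> sn be sumF.
pose B' k l := job_cell false (fun i => job_cell false (B i) l) k.
pose F' k l := job_cell 0 (fun i => job_cell 0 (F i) l) k.
have ms : memory (nats s) (reals s) s by [].
subst n; have [|t [s' [ex le [Ns' vs']]]] := @sum_loop_terminates _ alpha _ _ _ a b e B' F' ms.
  move=> i j v' s' li lj v'v [Ns' vs'] i2 j3.
  have := be (Ordinal li) (Ordinal lj) s' _ i2 j3.
  rewrite /B' /F' -[i]/(val (Ordinal li)) -[j]/(val (Ordinal lj)) !job_cell_ord.
  by apply; split=> // c k ca; rewrite vs' v'v.
exists t, s'; split=> //; split.
  by split=> // c k ca; rewrite vs' (negbTE ca).
move=> i; rewrite vs' eqxx ltn_ord /= -sumF; congr (_ + _).
by apply: eq_big => j; rewrite /B' /F' !job_cell_ord.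
Qed.

(** * The concrete program and its correctness *)

(** Among the masks 1, 2 and 3 only 3 has two bits, so one comparison yields the cardinality. *)
Lemma fix_codeE (A : {set 'I_2}) :
  A != finset.set0 -> #|A| = if (3 <= fix_code A)%N then 2%N else 1%N.
Proof.
rewrite -card_gt0 /fix_code -sum1_card [X in (0 < X)%N]big_mkcond.
rewrite [X in X = _]big_mkcond [X in (2 < X)%N]big_mkcond !big_ord_recl !big_ord0 /=.
by case: (_ \in _); case: (_ \in _).
Qed.

Definition same_job := BAnd (BNle loop_i loop_j) (BNle loop_j loop_i).
Definition two_processors := BNle (NConst 3) (NGet 1 loop_j).
(** The implication in [before] becomes a negated conjunction, as tests offer only [BNot] and
    [BAnd]. *)
Definition before_exp (x y : nexp) :=
  BAnd (BRle (RGet 4 x) (RGet 4 y))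
    (BNot (BAnd (BRle (RGet 4 y) (RGet 4 x)) (BNot (BNle x y)))).

(* Real arrays 4, 5 and 6 hold [scale], [weight] and (in every cell) [norm_cost]. *)
Definition scheduler : cmd :=
  Seq (sum_loop 4 (BAnd same_job (BNot two_processors)) (RGet 1 loop_j))
 (Seq (sum_loop 4 (BAnd same_job two_processors)
        (RMul (RPow (RConst (CNat 2)) (CDiv (CNat 1) CAlpha))
              (RDiv (RGet 1 loop_j) (RConst (CNat 2)))))
 (Seq (sum_loop 5 (before_exp loop_i loop_j) (RConst (CNat 1)))
 (Seq (sum_loop 6 (BNle (NConst 0) (NConst 0))
        (RMul (RGet 4 loop_j)
          (RPow (RGet 5 loop_j) (CDiv (CSub CAlpha (CNat 1)) CAlpha))))
 (Seq (sum_loop 3 same_job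
        (RMul (RPow (RDiv (RGet 6 loop_j) (RGet 0 (NConst 0)))
                    (CDiv (CNat 1) (CSub CAlpha (CNat 1))))
          (RMul (RGet 4 loop_j)
            (RPow (RGet 5 loop_j) (CDiv (CSub (CNat 0) (CNat 1)) CAlpha)))))
      (sum_loop 2 (BAnd (before_exp loop_j loop_i) (BNot (before_exp loop_i loop_j)))
        (RGet 3 loop_j)))))).

Lemma before_expE (R : realType) (alpha : R) (n : nat) (key : 'I_n -> R)
    (s : state R) (x y : nexp) (i j : 'I_n) :
  neval s x = i -> neval s y = j -> (forall k : 'I_n, reals s 4 k = key k) ->
  beval alpha s (before_exp x y) = before key i j.
Proof.
by move=> /= -> -> sk; rewrite !sk /before negb_and negbK implybE.
Qed.

(** Six loops of equal cost, each reading only arrays that it does not test or write itself; the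
    [frame] facts trace every array back to the phase that filled it, or to its initial content. *)
Lemma scheduler_spec (R : realType) (alpha : R) (n : nat) (I : instance R n) :
  valid_instance I ->
  terminates alpha (encode I) scheduler (6 * (n * (n * 4 + 4) + 2))
    (fun s => Defs.decode n s = sequential alpha I).
Proof.
move=> [fix0 V0 E0].
pose code (j : 'I_n) := fix_code (fix_of I j).
have same (i j : 'I_n) : (i <= j)%N && (j <= i)%N = (j == i).
  by rewrite -eqn_leq eq_sym.
have -> : (6 * (n * (n * 4 + 4) + 2))%N = (let T := n * (n * 4 + 4) + 2 in
    T + (T + (T + (T + (T + T)))))%N by rewrite /=; lia.
apply: terminates_seq.
  (* One-processor jobs have scale equal to their volume. The cells of the other jobs stay 0 until
     the next loop fills them. *)
  apply: (sum_loop_array (n := n)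
    (B := fun i j => (j == i) && ~~ (3 <= code j)%N) (F := fun _ j => volume I j)
    (f := fun j => if (3 <= code j)%N then 0 else volume I j)) => //.
    by move=> i j s' [Nf Rf] /= -> ->; rewrite Nf // Rf //= same !job_cell_ord.
  by move=> i /=; rewrite add0r big_mkcondr big_pred1_eq if_neg.
move=> s1 [[N1 R1] h1]; apply: terminates_seq.
  apply: (sum_loop_array (n := n)
    (B := fun i j => (j == i) && (3 <= code j)%N)
    (F := fun _ j => 2 `^ (1 / alpha) * (volume I j / 2))
    (f := scale alpha I)) => //; first by rewrite N1.
    by move=> i j s' [Nf Rf] /= -> ->; rewrite Nf // N1 // Rf // R1 //= same !job_cell_ord.
  move=> i; rewrite h1 big_mkcondr big_pred1_eq /scale /proc_work fix_codeE //.
  by case: ifP => _; rewrite ?add0r // powR1 invr1 mulr1 mul1r addr0.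
move=> s2 [[N2 R2] h2]; apply: terminates_seq.
  apply: (sum_loop_array (n := n) (B := before (scale alpha I))
    (F := fun _ _ => 1) (f := weight alpha I)) => //; first by rewrite N2 ?N1.
    move=> i j s' [Nf Rf] ei ej; split=> //; apply: before_expE => // k.
    by rewrite Rf.
  move=> i; rewrite R2 // R1 //= add0r /weight rankS -sum1_card natr_sum.
  by apply: eq_bigl => j; rewrite inE.
move=> s3 [[N3 R3] h3].
have h2' (j : 'I_n) : reals s3 4 j = scale alpha I j by rewrite R3.
apply: terminates_seq.
  apply: (sum_loop_array (n := n) (B := fun _ _ => true)
    (F := fun _ j => scale alpha I j * weight alpha I j `^ ((alpha - 1) / alpha))
    (f := fun _ => norm_cost alpha I)) => //; first by rewrite N3 ?N2 ?N1.
    by move=> i j s' [Nf Rf] /= _ ->; rewrite !Rf // h2' h3.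
  by move=> i; rewrite R3 // R2 // R1 //= add0r.
move=> s4 [[N4 R4] h4]; apply: terminates_seq.
  apply: (sum_loop_array (n := n) (B := fun i j => j == i)
    (F := fun _ j => opt_duration alpha I j)
    (f := opt_duration alpha I)) => //; first by rewrite N4 ?N3 ?N2 ?N1.
    move=> i j s' [Nf Rf] /= -> ->; rewrite !Rf // same h4 !R4 // h2' h3.
    by rewrite R3 // R2 // R1.
  by move=> i; rewrite R4 // R3 // R2 // R1 //= add0r big_pred1_eq.
move=> s5 [[N5 R5] h5].
have [|||t [s6 [ex le [[N6 R6] h6]]]] := @sum_loop_array _ alpha n s5 2
  (BAnd (before_exp loop_j loop_i) (BNot (before_exp loop_i loop_j))) (RGet 3 loop_j)
  (fun i j => before (scale alpha I) j i && ~~ before (scale alpha I) i j)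
  (fun _ j => opt_duration alpha I j) (opt_start alpha I).
- by rewrite N5 ?N4 ?N3 ?N2 ?N1.
- move=> i j s' [Nf Rf] ei ej; split; last by rewrite /= ej Rf // h5.
  have h (k : 'I_n) : reals s' 4 k = scale alpha I k by rewrite Rf // R5 // R4 // h2'.
  have ji : beval alpha s' (before_exp loop_j loop_i) = before (scale alpha I) j i.
    exact: before_expE.
  have ij : beval alpha s' (before_exp loop_i loop_j) = before (scale alpha I) i j.
    exact: before_expE.
  by rewrite -ji -ij.
- by move=> i; rewrite R5 // R4 // R3 // R2 // R1 //= add0r.
exists t, s6; split=> //; rewrite /Defs.decode /sequential.
by congr Schedule; apply/funext => j; rewrite ?h6 // R6 // h5.
Qed.

(** * Polynomial running time and approximation ratio *)

Theorem theorem5 (R : realType) (alpha : R) (halpha : 1 < alpha) :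
  exists p : cmd,
    poly_time_approx alpha (2 `^ ((2 * alpha - 1) / (alpha - 1))) p.
Proof.
(* The polynomial is [6 * (n * (n * 4 + 4) + 2)] expanded. *)
exists scheduler, (24%N%:P * 'X * 'X + 24%N%:P * 'X + 12%N%:P) => n I Iv.
have [t [s [ex le sE]]] := scheduler_spec alpha Iv.
exists t, s; split=> //.
  apply: leq_trans le _; rewrite !(hornerD, hornerM, hornerC, hornerX).
  rewrite !natrDE !natrME. nia.
have feas := sequential_feasible halpha Iv.
rewrite sE; split=> //.
set rho := _ `^ _.
(* The exponent is at least 1 because [2 * alpha - 1 >= alpha - 1]. *)
have rho2 : 2 <= rho.
  rewrite -[leLHS]powRr1 //; apply: ler_powR; first by rewrite ler1n.
  by rewrite ler_pdivlMr ?subr_gt0 //; lra.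
have rho0 : 0 < rho by apply: lt_le_trans rho2.
(* [opt_cost] is an infimum, so it suffices to bound every feasible schedule; the sequential one
   shows that the set is nonempty. *)
rewrite mulrC -ler_pdivrMr //; apply: lb_le_inf.
  by exists (total_completion (sequential alpha I)); exists (sequential alpha I).
move=> _ [S FS <-]; rewrite ler_pdivrMr // sequential_cost //.
apply: le_trans (feasible_lower_bound halpha Iv FS) _.
rewrite mulrC ler_wpM2l //; have [S0 D0 _ _] := FS.
by apply: sumr_ge0 => j _; rewrite addr_ge0 // ltW.
Qed.
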